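(* For every positive integer $n$, every finite extension problem $(\mathfrak{X},\tilde A)$ has a finite solution of the form $\mathfrak{X}_{\mathcal{P}}G$, for some $A$-generated group $G$, such that every weak substructure $\mathfrak{U}\subseteq\mathfrak{X}_{\mathcal{P}}G$ of weight at most $n$ admits a homomorphism $\phi\colon\mathfrak{U}\to\mathfrak{X}_{\mathcal{P}}F$.
   Context: Structures. Fix a finite relational signature $\sigma$. For a $\sigma$-structure $\mathfrak{X}=(X;(R^{\mathfrak{X}})_{R\in\sigma})$, a weak substructure is a $\sigma$-structure $\mathfrak{Z}$ with base set $Z\subseteq X$ and $R^{\mathfrak{Z}}\subseteq R^{\mathfrak{X}}$ for all $R$; it is induced if $R^{\mathfrak{Z}}=R^{\mathfrak{X}}\cap Z^r$ ($r$ the arity of $R$). $\mathfrak{Y}$ is an extension of $\mathfrak{X}$ if $\mathfrak{X}$ is an induced substructure of $\mathfrak{Y}$. The weight of $\mathfrak{U}$ is the number of elements contained in no relational tuple plus $\sum_{R}|R^{\mathfrak{U}}|$. Extension problems. A (finite) extension problem $(\mathfrak{X},\tilde A)$ consists of a (finite) $\sigma$-structure $\mathfrak{X}$ and a set $\tilde A=A\cup A^{-1}$ of partial automorphisms of $\mathfrak{X}$ (isomorphisms between induced substructures), closed under inversion; partial maps act on the right, $x\mapsto x\cdot a$. The elements of $A$ also serve as abstract symbols, in which case $A^{-1}$ is a disjoint set of formal inverses. A solution is an extension $\mathfrak{Y}$ of $\mathfrak{X}$ with automorphisms $\hat a$ of $\mathfrak{Y}$ ($a\in\tilde A$) such that $a\subseteq\hat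 a$ and $\hat a^{-1}=\widehat{a^{-1}}$. $\mathcal{P}$ is the $A$-labelled graph with vertex set $X$ and an edge $x_1\to x_2$ labelled $a\in\tilde A$ whenever $x_1\cdot a=x_2$. The structures $\mathfrak{X}_{\mathcal{P}}G$. An $A$-generated group is a group $G$ with a map $A\to G$ whose image generates $G$; $[a]_G$ is the value of $a\in\tilde A$. $F$ is the free group on $A$. Let $\Theta(\mathcal{P})$ be the smallest equivalence relation on $X\times G$ that is compatible with all operations $(x,g)\mapsto(x,g[a]_G)$, $a\in\tilde A$, and contains all pairs $((x_1,[a]_G),(x_2,1_G))$ with $a\in\tilde A$, $x_1\cdot a=x_2$. Put $X_{\mathcal{P}}G=(X\times G)/\Theta(\mathcal{P})$, and write $xg$ for the class of $(x,g)$; $G$ acts on $X_{\mathcal{P}}G$ on the right by $(xh)g=x(hg)$. $G$ extends $\mathcal{P}$ if the map $x\mapsto x1_G$ is injective on $X$ (this holds for $G=F$); then $X$ is regarded as a subset of $X_{\mathcal{P}}G$, and $\mathfrak{X}_{\mathcal{P}}G$ is the $\sigma$-structure on $X_{\mathcal{P}}G$ with $R^{\mathfrak{X}_{\mathcal{P}}G}=\bigcup_{g\in G}\{(x_1g,\dots,x_rg):(x_1,\dots,x_r)\in R^{\mathfrak{X}}\}$. That $\mathfrak{X}_{\mathcal{P}}G$ is a solution means that $G$ extends $\mathcal{P}$ and $\mathfrak{X}$ is an induced substructure of $\mathfrak{X}_{\mathcal{P}}G$, with $\hat a$ the map $y\mapsto y[a]_G$. *)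

(* Defs.v *)
From HB Require Import structures.
From mathcomp Require Import all_boot finmap.
From mathcomp Require Import boolp classical_sets cardinality.

Set Implicit Arguments.
Unset Strict Implicit.
Unset Printing Implicit Defensive.

Local Open Scope classical_set_scope.
Local Open Scope quotient_scope.
Local Open Scope group_scope.

Record signature := Signature { symbol :> finType; arity : symbol -> nat }.

Definition structure (sigma : signature) (T : Type) :=
  forall R : sigma, set ((arity R).-tuple T).

Definition homomorphism (sigma : signature) (T T' : Type)
    (S : structure sigma T) (S' : structure sigma T') (f : T -> T') : Prop :=
  forall R t, S R t -> S' R (map_tuple f t).

(* [f] identifies [(T, S)] with an induced substructure of [(T', S')]. *)
Definition induced_along (sigma : signature) (T T' : Type)
    (S : structure sigma T) (S' : structure sigma T') (f : T -> T') : Prop :=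
  injective f /\ forall R t, S R t <-> S' R (map_tuple f t).

Definition automorphism (sigma : signature) (T : Type)
    (S : structure sigma T) (f : T -> T) : Prop :=
  bijective f /\ forall R t, S R t <-> S R (map_tuple f t).

Definition weak_substructure (sigma : signature) (T : Type)
    (S : structure sigma T) (Z : set T) (U : structure sigma Z) : Prop :=
  forall R t, U R t -> S R (map_tuple val t).

Definition isolated (sigma : signature) (T : choiceType)
    (S : structure sigma T) : set T :=
  [set x | forall (R : sigma) (t : (arity R).-tuple T), S R t -> x \notin t].

(* As [fset_set] sends infinite sets to [fset0], this is the weight only when
   [T] is finite. *)
Definition weight (sigma : signature) (T : choiceType)
    (S : structure sigma T) : nat :=
  (#|` fset_set (isolated S) | + \sum_(R : sigma) #|` fset_set (S R) |)%N.

Definition partial_automorphism (sigma : signature) (T : finType)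
    (S : structure sigma T) (a : {ffun T -> option T}) : Prop :=
  (forall x y z, a x = Some z -> a y = Some z -> x = y) /\
  (forall (R : sigma) (t u : (arity R).-tuple T),
     (forall i, a (tnth t i) = Some (tnth u i)) -> (S R t <-> S R u)).

Definition pinv (T : finType) (a : {ffun T -> option T}) :
    {ffun T -> option T} :=
  [ffun y => [pick x | a x == Some y]].

Record ext_problem (sigma : signature) := ExtProblem {
  base : finType;
  base_str : structure sigma base;
  pauts : {set {ffun base -> option base}};
  pautsP : forall a, a \in pauts -> partial_automorphism base_str a }.

Notation letter A := (A * bool)%type.

Definition linv (A : Type) (s : letter A) : letter A := (s.1, ~~ s.2).

(* The elements of [A] as abstract symbols; [letter (labels E)] is the symmetric
   alphabet, [(a, true)] being the formal inverse of [(a, false)].  The formal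
   inverse of [a] differs from every symbol in [A], even if the partial map
   [pinv a] is in [A]. *)
Definition labels (sigma : signature) (E : ext_problem sigma) : finType :=
  {a : {ffun base E -> option (base E)} | a \in pauts E}.

Definition pval (sigma : signature) (E : ext_problem sigma)
    (s : letter (labels E)) : {ffun base E -> option (base E)} :=
  if s.2 then pinv (val s.1) else val s.1.

Record solution (sigma : signature) (E : ext_problem sigma) (Y : Type)
    (S : structure sigma Y) (iota : base E -> Y)
    (hat : letter (labels E) -> Y -> Y) : Prop := Solution {
  sol_ext : induced_along (base_str (e:=E)) S iota;
  sol_aut : forall s, automorphism S (hat s);
  sol_sub : forall s x y, pval s x = Some y -> hat s (iota x) = iota y;
  sol_inv : forall s, cancel (hat s) (hat (linv s)) }.

Definition generates (A : Type) (G : groupType) (f : A -> G) : Prop :=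
  forall H : {pred G}, group_closed H -> (forall a, f a \in H) ->
  forall g, g \in H.

Record generated_group (A : Type) := GeneratedGroup {
  ggroup :> groupType;
  ggen : A -> ggroup;
  ggenP : generates ggen }.

Definition lval (A : Type) (G : generated_group A) (s : letter A) : G :=
  if s.2 then (ggen G s.1)^-1 else ggen G s.1.

Definition reduced (A : choiceType) (w : seq (letter A)) : bool :=
  sorted (fun s t => t != linv s) w.

Record free_group (A : choiceType) := FreeGroup {
  fword :> seq (letter A);
  fwordP : reduced fword }.

HB.instance Definition _ (A : choiceType) := [isSub for @fword A].
HB.instance Definition _ (A : choiceType) := [Choice of free_group A by <:].

Definition lmul (A : choiceType) (s : letter A) (w : seq (letter A)) :=
  if w is t :: w' then if t == linv s then w' else s :: w else [:: s].

Definition wmul (A : choiceType) (u v : seq (letter A)) := foldr (@lmul A) v u.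

Definition winv (A : Type) (w : seq (letter A)) := rev (map (@linv A) w).

Lemma linvK (A : Type) : involutive (@linv A).
Proof. by case=> a b; rewrite /linv /= negbK. Qed.

Lemma linv_neq (A : choiceType) (s : letter A) : linv s != s.
Proof. by case: s => a [] /=; apply/eqP. Qed.

Lemma reduced_lmul (A : choiceType) (s : letter A) w :
  reduced w -> reduced (lmul s w).
Proof.
case: w => [|t w] //= h; case: ifP => [_|/negbT ne]; last by rewrite /reduced /= ne.
exact: path_sorted h.
Qed.

Lemma reduced_wmul (A : choiceType) (u v : seq (letter A)) :
  reduced v -> reduced (wmul u v).
Proof. by move=> rv; elim: u => //= s u; apply: reduced_lmul. Qed.

Lemma reduced_winv (A : choiceType) (w : seq (letter A)) :
  reduced w -> reduced (winv w).
Proof.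
rewrite /reduced /winv rev_sorted sorted_map; apply: sub_sorted => s t /=.
by rewrite linvK eq_sym.
Qed.

Lemma lmulK (A : choiceType) (s : letter A) w :
  reduced w -> lmul (linv s) (lmul s w) = w.
Proof.
case: w => [|t w] h /=; first by rewrite linvK eqxx.
case: eqP => [ts|ts] /=; last by rewrite linvK eqxx.
case: w h => [|r w] /=; rewrite -?ts // => /andP[/negbTE ne _].
by rewrite ne.
Qed.

Lemma wmul_lmul (A : choiceType) (s : letter A) u v :
  reduced v -> wmul (lmul s u) v = lmul s (wmul u v).
Proof.
move=> rv; case: u => [|t u] //=; case: eqP => //= ->.
by rewrite -{1}[s]linvK lmulK // reduced_wmul.
Qed.

Lemma wmulA (A : choiceType) (u v w : seq (letter A)) :
  reduced w -> wmul u (wmul v w) = wmul (wmul u v) w.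
Proof. by move=> rw; elim: u => //= s u ->; rewrite wmul_lmul. Qed.

Lemma wmulw0 (A : choiceType) (w : seq (letter A)) :
  reduced w -> wmul w [::] = w.
Proof.
elim: w => //= s w IH h; rewrite IH; last exact: path_sorted h.
by case: w h {IH} => //= t w /andP[/negbTE->].
Qed.

Lemma wmul_cat (A : choiceType) (u v w : seq (letter A)) :
  wmul (u ++ v) w = wmul u (wmul v w).
Proof. exact: foldr_cat. Qed.

Lemma wmulVw (A : choiceType) (w : seq (letter A)) :
  reduced w -> wmul (winv w) w = [::].
Proof.
elim: w => //= s w IH h; rewrite /winv /= rev_cons -cats1 wmul_cat /=.
by rewrite linvK eqxx IH //; apply: path_sorted h.
Qed.

Lemma winvK (A : Type) : involutive (@winv A).
Proof.
by move=> w; rewrite /winv map_rev revK (mapK (@linvK A)).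
Qed.

Definition fone (A : choiceType) : free_group A := @FreeGroup A [::] isT.
Definition fmul (A : choiceType) (u v : free_group A) : free_group A :=
  FreeGroup (reduced_wmul u (fwordP v)).
Definition finv (A : choiceType) (u : free_group A) : free_group A :=
  FreeGroup (reduced_winv (fwordP u)).

Lemma fmulA (A : choiceType) : associative (@fmul A).
Proof. by move=> u v w; apply: val_inj; apply: wmulA; apply: fwordP. Qed.
Lemma fmul1g (A : choiceType) : left_id (@fone A) (@fmul A).
Proof. by move=> u; apply: val_inj. Qed.
Lemma fmulg1 (A : choiceType) : right_id (@fone A) (@fmul A).
Proof. by move=> u; apply: val_inj; apply: wmulw0; apply: fwordP. Qed.
Lemma fmulVg (A : choiceType) : left_inverse (@fone A) (@finv A) (@fmul A).
Proof. by move=> u; apply: val_inj; apply: wmulVw; apply: fwordP. Qed.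
Lemma fmulgV (A : choiceType) : right_inverse (@fone A) (@finv A) (@fmul A).
Proof.
move=> u; apply: val_inj => /=; rewrite -{1}[u : seq _]winvK.
exact: wmulVw (reduced_winv (fwordP u)).
Qed.

HB.instance Definition _ (A : choiceType) :=
  isGroup.Build (free_group A)
    (@fmulA A) (@fmul1g A) (@fmulg1 A) (@fmulVg A) (@fmulgV A).

Definition fgen (A : choiceType) (a : A) : free_group A :=
  @FreeGroup A [:: (a, false)] isT.

Lemma fgen_generates (A : choiceType) : generates (@fgen A).
Proof.
move=> H [H1 Hd] Ha [w rw].
have Hv x : x \in H -> x^-1 \in H by move=> Hx; rewrite -[x^-1]mul1g; apply: Hd.
have Hm x y : x \in H -> y \in H -> x * y \in H.
  by move=> Hx Hy; rewrite -[y]invgK; apply: Hd => //; apply: Hv.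
elim: w rw => [|s w IH] rw; first by rewrite (_ : FreeGroup _ = 1) //; apply: val_inj.
have rw' : reduced w by apply: path_sorted rw.
have -> : FreeGroup rw = FreeGroup (isT : reduced [:: s]) * FreeGroup rw'.
  by apply: val_inj => /=; case: w rw {IH rw'} => //= t w /andP[/negbTE->].
apply: Hm (IH _); case: s {rw} => a [].
  rewrite (_ : FreeGroup _ = (fgen a)^-1); first by apply: Hv.
  exact: val_inj.
by rewrite (_ : FreeGroup _ = fgen a) //; apply: val_inj.
Qed.

Definition free_generated (A : choiceType) : generated_group A :=
  GeneratedGroup (@fgen_generates A).

Inductive Theta (sigma : signature) (E : ext_problem sigma)
    (G : generated_group (labels E)) : base E * G -> base E * G -> Prop :=
| Theta_refl p : Theta p p
| Theta_sym p q : Theta p q -> Theta q p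
| Theta_trans p q r : Theta p q -> Theta q r -> Theta p r
| Theta_compat (s : letter (labels E)) x g y h :
    Theta (x, g) (y, h) -> Theta (x, g * lval G s) (y, h * lval G s)
| Theta_edge (s : letter (labels E)) x1 x2 :
    pval s x1 = Some x2 -> Theta (x1, lval G s) (x2, 1).

Definition thetab (sigma : signature) (E : ext_problem sigma)
    (G : generated_group (labels E)) : rel (base E * G) :=
  fun p q => `[< Theta p q >].

Lemma thetab_refl (sigma : signature) (E : ext_problem sigma)
    (G : generated_group (labels E)) : reflexive (@thetab sigma E G).
Proof. by move=> p; apply/asboolP/Theta_refl. Qed.

Lemma thetab_sym (sigma : signature) (E : ext_problem sigma)
    (G : generated_group (labels E)) : symmetric (@thetab sigma E G).
Proof. by move=> p q; apply/asboolP/asboolP; apply: Theta_sym. Qed.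

Lemma thetab_trans (sigma : signature) (E : ext_problem sigma)
    (G : generated_group (labels E)) : transitive (@thetab sigma E G).
Proof.
by move=> q p r /asboolP pq /asboolP qr; apply/asboolP; apply: Theta_trans pq qr.
Qed.

Canonical theta_equiv (sigma : signature) (E : ext_problem sigma)
    (G : generated_group (labels E)) :=
  EquivRel (@thetab sigma E G) (@thetab_refl _ E G) (@thetab_sym _ E G)
    (@thetab_trans _ E G).

Definition XP (sigma : signature) (E : ext_problem sigma)
    (G : generated_group (labels E)) : choiceType :=
  {eq_quot theta_equiv G}.

Definition xcls (sigma : signature) (E : ext_problem sigma)
    (G : generated_group (labels E)) (x : base E) (g : G) : XP G :=
  \pi_({eq_quot theta_equiv G}) (x, g).

Definition xact (sigma : signature) (E : ext_problem sigma)
    (G : generated_group (labels E)) (y : XP G) (g : G) : XP G :=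
  let p := repr (y : {eq_quot theta_equiv G}) in xcls p.1 (p.2 * g).

Definition XPstr (sigma : signature) (E : ext_problem sigma)
    (G : generated_group (labels E)) : structure sigma (XP G) :=
  fun R => [set t | exists (g : G) (u : (arity R).-tuple (base E)),
    base_str u /\ t = map_tuple (fun x => xcls x g) u].

Definition XPincl (sigma : signature) (E : ext_problem sigma)
    (G : generated_group (labels E)) (x : base E) : XP G := xcls x 1.

Definition XPhat (sigma : signature) (E : ext_problem sigma)
    (G : generated_group (labels E)) (s : letter (labels E)) (y : XP G) : XP G :=
  xact y (lval G s).

Arguments XPstr {sigma E} G R _.
Arguments XPincl {sigma E} G x.
Arguments XPhat {sigma E} G s y.

Lemma xcls_eqP (sigma : signature) (E : ext_problem sigma)
    (G : generated_group (labels E)) (x y : base E) (g h : G) :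
  xcls x g = xcls y h <-> Theta (x, g) (y, h).
Proof.
by split=> [/eqmodP/asboolP|]; last by move=> gh; apply/eqmodP/asboolP.
Qed.

Lemma Theta_mulr (sigma : signature) (E : ext_problem sigma)
    (G : generated_group (labels E)) (k : G) (x y : base E) (g h : G) :
  Theta (x, g) (y, h) -> Theta (x, g * k) (y, h * k).
Proof.
pose P k := `[< forall x y g h, Theta (x, g) (y, h) ->
  Theta (G := G) (x, g * k) (y, h * k) /\ Theta (x, g / k) (y, h / k) >].
suff: k \in [pred k | P k] by move=> /asboolP H /H[].
apply: (ggenP (g := G)) => [|a]; last first.
  apply/asboolP => {}x {}y {}g {}h H; split.
    exact: (Theta_compat (a, false) H).
  exact: (Theta_compat (a, true) H).
split=> [|k1 k2 /asboolP H1 /asboolP H2]; apply/asboolP => {}x {}y {}g {}h H.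
  by rewrite invg1 !mulg1.
rewrite !mulgA invgF !mulgA; split.
  by have [K _] := H1 _ _ _ _ H; have [] := H2 _ _ _ _ K.
by have [K _] := H2 _ _ _ _ H; have [] := H1 _ _ _ _ K.
Qed.

(* The action does not depend on the representatives chosen in [xact]. *)
Lemma xactE (sigma : signature) (E : ext_problem sigma)
    (G : generated_group (labels E)) (x : base E) (g h : G) :
  xact (xcls x h) g = xcls x (h * g).
Proof.
rewrite /xact; apply/xcls_eqP/Theta_mulr/xcls_eqP.
by rewrite /xcls -surjective_pairing reprK.
Qed.

(* Main.v *)
(** A homomorphism from a small weak substructure of X_P G to X_P F amounts to
    lifting the group elements that carry its tuples from G to F, so that words
    of F mapping x to y in P witness the identifications made by Theta(P).  Such
    words correspond to paths in a Cayley graph, and what they do to P depends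
    only on their value in a finite group K extending the partial maps and on
    the set of edges of the Cayley graph of K that they traverse.  Hence it
    suffices to find, for each m, a finite H such that any m vertices of its
    Cayley graph lift to F with the following property: if w leads from g to g',
    then the quotient of the lifts of g and g' is the value of a word w' with the
    same value as w in K, traversing only edges traversed by w.

    Such an H is obtained by iterating the mod 2 expansion, in the manner of
    Auinger and Steinberg.  In the expansion of K', every edge e of the Cayley
    graph of K' splits the m vertices into two parts, and each word joining
    vertices of different parts traverses e.  Two vertices with distinct values
    in K' are joined by a path of edges separating them, and some vertex x of
    this path cuts the configuration into parts that, even with x added, have
    fewer than m vertices.  These lift by induction, and their lifts are glued
    at x. *)
From mathcomp Require Import fingroup perm zify.
Require Import Defs.
From mathcomp Require Import all_boot finmap.
From mathcomp Require Import boolp classical_sets cardinality.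

Set Implicit Arguments.
Unset Strict Implicit.
Unset Printing Implicit Defensive.

(** * Words and their paths in Cayley graphs *)

Section CayleyPaths.

Local Open Scope group_scope.

Variable A : choiceType.

Definition lev (G : groupType) (gen : A -> G) (s : letter A) : G :=
  if s.2 then (gen s.1)^-1 else gen s.1.

Fixpoint wev (G : groupType) (gen : A -> G) (w : seq (letter A)) : G :=
  if w is s :: w' then lev gen s * wev gen w' else 1.

(* Inverse letters traverse the edge of the Cayley graph backwards. *)
Definition edge (G : groupType) (gen : A -> G) (k : G) (s : letter A) : G * A :=
  if s.2 then (k * lev gen s, s.1) else (k, s.1).

Fixpoint traversed (G : groupType) (gen : A -> G) (k : G) (w : seq (letter A)) :
    seq (G * A) :=
  if w is s :: w' then edge gen k s :: traversed gen (k * lev gen s) w' else [::].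

Definition pass (G : groupType) (gen : A -> G) (k : G) (w : seq (letter A))
    (x : G) : Prop :=
  exists u v, w = u ++ v /\ k * wev gen u = x.

Definition below (G : groupType) (gen : A -> G) (w' w : seq (letter A)) : Prop :=
  wev gen w' = wev gen w /\
  forall k, {subset traversed gen k w' <= traversed gen k w}.

Definition reach (G : groupType) (gen : A -> G) (g : G) : Prop :=
  exists w, g = wev gen w.

(** Maps of Cayley graphs rather than homomorphisms: [bar] is defined on a whole permutation group,
    and left translations are wanted too. *)
Definition equivariant (G H : groupType) (genG : A -> G) (genH : A -> H)
    (f : G -> H) : Prop :=
  forall k s, f (k * lev genG s) = f k * lev genH s.

Lemma winv_cons (s : letter A) w : winv (s :: w) = winv w ++ [:: linv s].
Proof. by rewrite /winv /= rev_cons -cats1. Qed.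

Section OneGroup.

Variables (G : groupType) (gen : A -> G).

Lemma wev_cat u v : wev gen (u ++ v) = wev gen u * wev gen v.
Proof. by elim: u => [|s u IH] /=; rewrite ?mul1g // IH mulgA. Qed.

Lemma lev_linv s : lev gen (linv s) = (lev gen s)^-1.
Proof. by case: s => a [] //=; rewrite /lev /= invgK. Qed.

Lemma wev_winv w : wev gen (winv w) = (wev gen w)^-1.
Proof.
elim: w => [|s w IH]; first by rewrite /= invg1.
by rewrite winv_cons wev_cat /= IH lev_linv mulg1 invgM.
Qed.

Lemma edge_linv k s : edge gen (k * lev gen s) (linv s) = edge gen k s.
Proof. by case: s => a [] //; rewrite /edge /lev /= ?mulgK ?mulgVK. Qed.

Lemma traversed_cat k u v :
  traversed gen k (u ++ v) = traversed gen k u ++ traversed gen (k * wev gen u) v.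
Proof. by elim: u k => [|s u IH] k /=; rewrite ?mulg1 // IH mulgA. Qed.

Lemma traversed_winv k w :
  traversed gen (k * wev gen w) (winv w) = rev (traversed gen k w).
Proof.
elim: w k => [|s w IH] k //=.
rewrite winv_cons traversed_cat /= mulgA IH rev_cons -cats1; congr (_ ++ [:: _]).
by rewrite wev_winv mulgK edge_linv.
Qed.

Lemma traversed_pass k s x w :
  edge gen x s \in traversed gen k w ->
  pass gen k w x /\ pass gen k w (x * lev gen s).
Proof.
elim: w k => [|t w IH] k //=; rewrite inE => /orP[/eqP e|/IH]; last first.
  by case=> [[u1 [v1 [e1 <-]]] [u2 [v2 [e2 <-]]]]; split;
    [exists (t :: u1), v1; rewrite e1|exists (t :: u2), v2; rewrite e2];
    rewrite /= mulgA.
have p0 : pass gen k (t :: w) k by exists [::], (t :: w); rewrite mulg1.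
have p1 : pass gen k (t :: w) (k * lev gen t).
  by exists [:: t], w; rewrite /= mulg1.
case: s t {IH} e p0 p1 => [a []] [b []]; rewrite /edge /lev /= => -[e eab];
  rewrite -eab in e *.
- by move/mulIg: e => ->.
- by rewrite -e mulgVK.
- by rewrite e mulgVK.
- by rewrite e.
Qed.

Lemma below_nil w : wev gen w = 1 -> below gen [::] w.
Proof. by move=> e; split=> // k. Qed.

Lemma below_cat u' u v' v :
  below gen u' u -> below gen v' v -> below gen (u' ++ v') (u ++ v).
Proof.
move=> [eu hu] [ev hv]; split=> [|k]; first by rewrite !wev_cat eu ev.
move=> e; rewrite !traversed_cat !mem_cat eu.
by case/orP=> [/hu ->//|/hv ->]; rewrite orbT.
Qed.

End OneGroup.

Section TwoGroups.

Variables (G H : groupType) (genG : A -> G) (genH : A -> H) (f : G -> H).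
Hypothesis fE : equivariant genG genH f.

Lemma equivariant_wev k w : f (k * wev genG w) = f k * wev genH w.
Proof.
by elim: w k => [|s w IH] k /=; rewrite ?mulg1 // !mulgA IH fE.
Qed.

Lemma traversed_equivariant k w :
  traversed genH (f k) w = [seq (f e.1, e.2) | e <- traversed genG k w].
Proof.
elim: w k => [|s w IH] k //=; rewrite -fE IH; congr cons.
by case: s => a []; rewrite /edge //= -fE.
Qed.

End TwoGroups.

(** Left translations are automorphisms of the Cayley graph, so one starting point suffices. *)
Lemma below_at (G : groupType) (gen : A -> G) k w' w :
  wev gen w' = wev gen w -> {subset traversed gen k w' <= traversed gen k w} ->
  below gen w' w.
Proof.
move=> e sub; split=> // k'.
have tE : equivariant gen gen (fun x => k' * k^-1 * x).
  by move=> x s; rewrite !mulgA.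
have -> : k' = k' * k^-1 * k by rewrite mulgVK.
by rewrite !(traversed_equivariant tE) => e' /mapP[e0 /sub e0w ->]; apply: map_f.
Qed.

Lemma below_equivariant (G H : groupType) (genG : A -> G) (genH : A -> H)
    (f : G -> H) w' w :
  equivariant genG genH f -> below genG w' w -> below genH w' w.
Proof.
move=> fE [e sub]; apply: (@below_at _ _ (f 1)).
  by apply: (mulgI (f 1)); rewrite -!(equivariant_wev fE) e.
by rewrite !(traversed_equivariant fE) => e' /mapP[e0 /sub e0w ->]; apply: map_f.
Qed.

Lemma equivariant_reach (G H : groupType) (genG : A -> G) (genH : A -> H)
    (f : G -> H) g :
  equivariant genG genH f -> f 1 = 1 -> reach genG g -> reach genH (f g).
Proof.
by move=> fE f1 [w ->]; exists w; rewrite -[wev _ _]mul1g (equivariant_wev fE) f1 mul1g.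
Qed.

End CayleyPaths.

(** * Paths modulo 2 *)

Lemma even_count (T : eqType) (P : pred T) (s : seq T) :
  (forall e, P e -> ~~ odd (count_mem e s)) -> ~~ odd (count P s).
Proof.
(* Strong induction on the size, removing all copies of the head [x] at once. *)
elim: {s}_.+1 {-2}s (ltnSn (size s)) => // n IH [|x s] // sn hs.
set t := x :: s in sn hs *.
pose t' := [seq y <- t | y != x].
have -> : count P t = (P x * count_mem x t + count P t')%N.
  elim: t {sn hs} @t' => [|y t IHt] /=; first by rewrite muln0.
  rewrite IHt; case: eqVneq => [->|_] /=; case: (P x); rewrite ?mul1n ?mul0n //;
    lia.
rewrite oddD negb_add (_ : odd (P x * _) = false); last first.
  by apply/negbTE; case: (boolP (P x)) => [/hs|_]; rewrite ?mul1n ?mul0n.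
rewrite eq_sym eqbF_neg; apply: IH => [|e Pe].
  rewrite /t' /t /= eqxx /=; apply: leq_ltn_trans (sn : size s < n)%N.
  by rewrite size_filter count_size.
rewrite /t' count_filter; have [->|ne] := eqVneq e x.
  by rewrite (eq_count (a2 := pred0)) ?count_pred0 // => y /=; case: eqP.
rewrite (eq_count (a2 := pred1 e)) ?hs // => y /=.
by case: eqP => // ->; rewrite ne.
Qed.

Section Support.

Local Open Scope group_scope.

Variables (A : choiceType) (G : groupType) (gen : A -> G).

Lemma odd_crossing (C : pred G) k w :
  odd (count (fun e => C e.1 != C (e.1 * gen e.2)) (traversed gen k w)) =
  (C k != C (k * wev gen w)).
Proof.
elim: w k => [|s w IH] k /=; first by rewrite mulg1 eqxx.
rewrite oddD IH mulgA.
have -> : (C (edge gen k s).1 != C ((edge gen k s).1 * gen (edge gen k s).2)) =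
    (C k != C (k * lev gen s)).
  by case: s => a []; rewrite /edge /lev //= mulgVK eq_sym.
by case: (C k); case: (C (k * lev gen s)); case: (C _).
Qed.

(* Mod 2, the traversal counts of a path form a chain with boundary its two
   endpoints, which thus lie in the same component of the support. *)
Lemma odd_support_path k w :
  exists u, wev gen u = wev gen w /\
    forall e, e \in traversed gen k u -> odd (count_mem e (traversed gen k w)).
Proof.
pose supp := [pred e | odd (count_mem e (traversed gen k w))].
(* [C] is the component of [k] in the graph of oddly traversed edges. No such edge leaves it ([CE]),
   so its boundary is crossed evenly often. *)
pose C x := `[< exists u, k * wev gen u = x /\ all supp (traversed gen k u) >].
suff: C (k * wev gen w).
  by move=> /asboolP[u [/mulgI eu /allP su]]; exists u.
have Ck : C k by apply/asboolP; exists [::]; rewrite mulg1.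
have CE e : supp e -> C e.1 = C (e.1 * gen e.2).
  move=> se; apply/asboolP/asboolP => -[u [eu su]].
    exists (u ++ [:: (e.2, false)]); rewrite wev_cat /= mulg1 mulgA eu; split=> //.
    rewrite traversed_cat all_cat su /= eu /edge /= -surjective_pairing andbT.
    exact: se.
  exists (u ++ [:: (e.2, true)]); rewrite wev_cat /= mulg1 mulgA eu /lev /= mulgK.
  split=> //; rewrite traversed_cat all_cat su /= eu /edge /lev /= mulgK.
  by rewrite -surjective_pairing andbT.
move: (odd_crossing C k w); rewrite Ck; case: (C (k * wev gen w)) => // oc.
have /negP[] : ~~ odd (count (fun e => C e.1 != C (e.1 * gen e.2)) (traversed gen k w)).
  by apply: even_count => e; apply: contra => /CE ->.
by rewrite oc.
Qed.

End Support.

(** * The mod 2 expansion of a finite group *)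

Section Expansion.

Local Open Scope group_scope.

Variables (A : finType) (K : finGroupType) (gen : A -> K).

Definition step (a : A) (p : {ffun K * A -> bool} * K) :
    {ffun K * A -> bool} * K :=
  ([ffun e => p.1 e (+) (e == (p.2, a))], p.2 * gen a).

Lemma step_inj a : injective (step a).
Proof.
move=> [S k] [S' k'] [eS /mulIg ek]; rewrite -ek in eS *; congr (_, _).
by apply/ffunP => e; move/ffunP/(_ e): eS; rewrite !ffunE => /addIb.
Qed.

(* Generates the largest extension of [K] by an elementary abelian 2-group: the
   value of a word records its value in [K] and, mod 2, how often its path in
   the Cayley graph of [K] traverses each edge. *)
Definition egen (a : A) : {perm {ffun K * A -> bool} * K} := perm (@step_inj a).

Definition origin : {ffun K * A -> bool} * K := ([ffun=> false], 1).
Definition bar (g : {perm {ffun K * A -> bool} * K}) : K := (g origin).2.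
Definition parity (g : {perm {ffun K * A -> bool} * K}) : {ffun K * A -> bool} :=
  (g origin).1.

Lemma lev_egen s p :
  lev egen s p =
    ([ffun e => p.1 e (+) (e == edge gen p.2 s)], p.2 * lev gen s).
Proof.
case: s p => a [] [S k]; rewrite /lev /edge /=; last by rewrite permE.
apply: (@perm_inj _ (egen a)); rewrite permKV permE /step /= mulgVK.
by congr (_, _); apply/ffunP => e; rewrite !ffunE addbK.
Qed.

Lemma bar_equivariant : equivariant egen gen bar.
Proof. by move=> g s; rewrite /bar permM lev_egen. Qed.

Lemma bar1 : bar 1 = 1.
Proof. by rewrite /bar perm1. Qed.

Lemma parity_wev g w e :
  parity (g * wev egen w) e = parity g e (+) odd (count_mem e (traversed gen (bar g) w)).
Proof.
elim: w g => [|s w IH] g /=; first by rewrite mulg1 addbF.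
rewrite mulgA IH bar_equivariant /parity permM lev_egen ffunE /= oddD.
by rewrite oddb addbA eq_sym.
Qed.

Lemma parity_neq g w e :
  parity g e != parity (g * wev egen w) e -> e \in traversed gen (bar g) w.
Proof.
rewrite parity_wev -has_pred1 has_count; case: (count_mem _ _) => //.
by rewrite addbF eqxx.
Qed.

End Expansion.

Arguments bar {A K} g.
Arguments parity {A K} g.

(** * Lifting vertices from a finite group to the free group *)

Section Lifting.

Local Open Scope group_scope.

Variables (A : finType) (K : groupType) (gen : A -> K).

(** [below] refers to [K], which stays fixed while [H] is expanded repeatedly. *)
Definition lifts (H : finGroupType) (genH : A -> H) (V : {set H}) : Prop :=
  exists h : H -> free_group A, forall g w, g \in V -> g * wev genH w \in V ->
  exists w', below gen w' w /\ h g * wev (@fgen A) w' = h (g * wev genH w).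

Definition lifting (m : nat) (H : finGroupType) (genH : A -> H) : Prop :=
  forall V : {set H}, (#|V| <= m)%N ->
  (forall g, g \in V -> reach genH g) -> lifts genH V.

Variables (m : nat) (K' : finGroupType) (gen' : A -> K') (f : K' -> K).
Hypothesis fE : equivariant gen' gen f.
Hypothesis liftK' : lifting m gen'.

Local Notation egen' := (egen gen').
Local Notation cover := {perm {ffun K' * A -> bool} * K'}.

Lemma reach_bar g : reach egen' g -> reach gen' (bar g).
Proof. exact: (equivariant_reach (bar_equivariant gen') (bar1 _ _)). Qed.

Lemma lifts_bar (V : {set cover}) :
  (forall g, g \in V -> reach egen' g) -> (#|bar @: V| <= m)%N ->
  lifts egen' V.
Proof.
move=> Vr Vm; have [|h hP] := liftK' Vm.
  by move=> _ /imsetP[g /Vr/reach_bar gr ->].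
exists (fun g => h (bar g)) => g w gV gwV.
have bE := equivariant_wev (bar_equivariant gen') g w.
by rewrite bE; apply: hP; rewrite -?bE imset_f.
Qed.

(* Partial lifts are normalised to agree at [x], and are then combined since all
   words between different classes pass through [x]. *)
Lemma lifts_glue (V : {set cover}) (I : eqType) (kappa : cover -> I) x :
  (forall g, g \in V -> reach egen' g) -> reach gen' x ->
  (forall g w, g \in V -> g * wev egen' w \in V ->
    kappa g != kappa (g * wev egen' w) -> pass gen' (bar g) w x) ->
  (forall c, (#|[set g in V | kappa g == c]| < m)%N) -> lifts egen' V.
Proof.
move=> Vr xr Vx Vm.
pose W c := x |: bar @: [set g in V | kappa g == c].
have /choice[h hP] c : exists h : K' -> free_group A, h x = 1 /\
    forall k w, k \in W c -> k * wev gen' w \in W c ->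
    exists w', below gen w' w /\ h k * wev (@fgen A) w' = h (k * wev gen' w).
  have [||h hP] := @liftK' (W c).
  - rewrite cardsU1; apply: leq_trans (Vm c); rewrite -add1n leq_add ?leq_b1 //.
    exact: leq_imset_card.
  - move=> k /setU1P[->//|/imsetP[g]]; rewrite inE => /andP[gV _] ->.
    exact/reach_bar/Vr.
  exists (fun k => (h x)^-1 * h k); rewrite mulVg; split=> // k w kW kwW.
  have [w' [bw' e]] := hP k w kW kwW.
  by exists w'; rewrite -mulgA e.
have WP g c : g \in V -> kappa g = c -> bar g \in W c.
  by move=> gV <-; rewrite inE imset_f ?orbT // inE gV eqxx.
exists (fun g => h (kappa g) (bar g)) => g w gV gwV.
have bE := equivariant_wev (bar_equivariant gen') g w.
rewrite bE; have [ek|nk] := eqVneq (kappa g) (kappa (g * wev egen' w)).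
  by rewrite -ek; apply: (hP _).2; rewrite -?bE WP.
(* The word splits at [x]: [u] is replaced within the class of [g], [v] within that of the
   endpoint. *)
have [u [v [ew eu]]] := Vx g w gV gwV nk.
have [u' [bu' eu']] : exists u', below gen u' u /\
    h (kappa g) (bar g) * wev (@fgen A) u' = 1.
  rewrite -(hP (kappa g)).1 -eu; apply: (hP _).2; first exact: WP.
  by rewrite eu setU11.
have exv : x * wev gen' v = bar g * wev gen' w by rewrite ew wev_cat -eu mulgA.
have [v' [bv' ev']] : exists v', below gen v' v /\
    wev (@fgen A) v' = h (kappa (g * wev egen' w)) (bar g * wev gen' w).
  rewrite -exv; set c := kappa _.
  have [||v' [bv' ev']] := (hP c).2 x v; rewrite ?setU11 //.
    by rewrite exv -bE WP.
  by exists v'; rewrite -ev' (hP c).1 mul1g.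
exists (u' ++ v'); split; first by rewrite ew; apply: below_cat.
by rewrite wev_cat mulgA eu' mul1g.
Qed.

Definition isolates (V : {set cover}) i x : Prop :=
  forall g w, g \in V -> g * wev egen' w \in V ->
  (g == i) != (g * wev egen' w == i) -> pass gen' (bar g) w x.

(** For [V] with [m.+1] elements: at least two on each side of [e], so that both sides have room for
    one more vertex. *)
Definition splits (V : {set cover}) e : Prop :=
  forall c, (#|[set g in V | parity g e == c]| < m)%N.

Lemma isolates_start V i : isolates V i (bar i).
Proof.
move=> g w gV gwV; have [-> _|_] := eqVneq g i.
  by exists [::], w; rewrite mulg1.
have [<- _|_] := eqVneq (g * wev egen' w) i; last by rewrite eqxx.
exists w, [::]; rewrite cats0.
by rewrite (equivariant_wev (bar_equivariant gen')).
Qed.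

(* Each edge of the path splits [V] into two parts.  If none of them leaves at
   least two points on both sides, then each isolates [i] or [j]; take the last
   vertex before the first edge isolating [j]. *)
Lemma isolates_walk (V : {set cover}) i j x u :
  i \in V -> j \in V -> (#|V| <= m.+1)%N -> isolates V i x -> reach gen' x ->
  x * wev gen' u = bar j ->
  (forall e, e \in traversed gen' x u -> parity i e != parity j e) ->
  (exists y, [/\ reach gen' y, isolates V i y & isolates V j y]) \/
  (exists y s, reach gen' y /\ splits V (edge gen' y s)).
Proof.
move=> iV jV Vm; elim: u x => [|s u IH] x xi xr /=.
  rewrite mulg1 => e0 _; left; exists (bar j); split.
  - by rewrite -e0.
  - by rewrite -e0.
  - exact: isolates_start.
rewrite mulgA => xj su; set e := edge gen' x s.
have [sp|/existsNP[c /negP]] := pselect (splits V e).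
  by right; exists x, s.
rewrite -leqNgt => cm.
have xsr : reach gen' (x * lev gen' s).
  by case: xr => wx ->; exists (wx ++ [:: s]); rewrite wev_cat /= mulg1.
(* A class of at least [m] elements leaves at most one element of [V] outside. *)
have one l g : l \in V -> parity l e != c -> g \in V -> (g == l) = (parity g e != c).
  move=> lV lc gV; apply/eqP/idP => [->//|gc].
  have /card_le1P le1 : (#|[set g in V | parity g e != c]| <= 1)%N.
    rewrite -(leq_add2l #|[set g in V | parity g e == c]|).
    rewrite addn1 (leq_trans _ (cm : m < _.+1)%N) //.
    rewrite (leq_trans _ Vm) // -(cardsID [set g | parity g e == c] V).
    by apply/eq_leq; congr (_ + _)%N; apply: eq_card => y; rewrite !inE // andbC.
  have lB : l \in [set g in V | parity g e != c] by rewrite inE lV.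
  by apply/eqP; have := le1 l lB g; rewrite !inE gV gc => <-.
have iso l y : l \in V -> parity l e != c ->
    (forall (g : cover) w, e \in traversed gen' (bar g) w -> pass gen' (bar g) w y) ->
    isolates V l y.
  move=> lV lc py g w gV gwV; rewrite !(one l) // => ne; apply: py; apply: parity_neq.
  by apply: contra ne => /eqP->.
(* If [i] is in the large class [c], then [e] isolates [j]; so does its end [x], which already
   isolates [i]. Otherwise [e] isolates [i], and the walk moves on to its other end. *)
have [ic|ic] := eqVneq (parity i e) c.
  left; exists x; split=> //; apply: iso => //.
    by rewrite -ic eq_sym su // mem_head.
  by move=> g w /traversed_pass[].
apply: (IH (x * lev gen' s)) => //.
  by apply: iso => // g w /traversed_pass[].
by move=> e' e'u; apply: su; rewrite inE e'u orbT.
Qed.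

(** For [m] equal to 1, gluing would need empty classes. Instead [i] lifts to 1, and a distinct [j]
    to the value of a path of edges separating them, all of which are traversed by every word from
    [i] to [j]. *)
Lemma lifts_pair i j w0 : i * wev egen' w0 = j -> lifts egen' [set i; j].
Proof.
move=> ij.
have bE g w : bar (g * wev egen' w) = bar g * wev gen' w.
  exact: equivariant_wev (bar_equivariant gen') g w.
have [u [eu su]] := odd_support_path gen' (bar i) w0.
have iu : bar i * wev gen' u = bar j by rewrite eu -bE ij.
have sub e : e \in traversed gen' (bar i) u -> parity i e != parity j e.
  by move/su => oe; rewrite -ij parity_wev oe addbT; case: (parity i e).
have low w : wev egen' w = 1 -> below gen [::] w.
  move=> w1; apply: (below_equivariant fE); apply: below_nil.
  by apply: (mulgI (bar (1 : cover))); rewrite -bE w1 mulg1 mulg1.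
exists (fun g => if g == i then 1 else wev (@fgen A) u) => g w.
have [ne|ne] := eqVneq i j.
  rewrite -ne finset.setUid !inE => /eqP-> /eqP e; exists [::]; rewrite e eqxx mulg1.
  by split=> //; apply: low; apply: (mulgI i); rewrite e mulg1.
have ji := negbTE ne; rewrite eq_sym in ji.
rewrite !inE => /orP[]/eqP-> /orP[]/eqP e; rewrite e ?eqxx ?ji.
- by exists [::]; rewrite mulg1; split=> //; apply/low/(mulgI i); rewrite e mulg1.
- exists u; rewrite mul1g; split=> //; apply: (below_equivariant fE).
  apply: (@below_at _ _ _ (bar i)).
    by apply: (mulgI (bar i)); rewrite iu -bE e.
  by move=> x /sub ne'; apply: parity_neq; rewrite e.
- exists (winv u); rewrite wev_winv mulgV; split=> //.
  apply: (below_equivariant fE); apply: (@below_at _ _ _ (bar j)).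
    by apply: (mulgI (bar j)); rewrite wev_winv -bE e -iu mulgK.
  rewrite -iu traversed_winv => x; rewrite mem_rev iu => /sub ne'.
  by apply: parity_neq; rewrite e eq_sym.
- by exists [::]; rewrite mulg1; split=> //; apply/low/(mulgI j); rewrite e mulg1.
Qed.

Lemma lifting_egen : (0 < m)%N -> lifting m.+1 egen'.
Proof.
move=> m0 V Vm Vr; have [/(lifts_bar Vr)//|barV] := leqP #|bar @: V| m.
have mV := leq_trans barV (leq_imset_card bar V).
have [i [j [iV jV ij]]] := card_gt1P (leq_ltn_trans m0 mV).
have [[wi ei] [wj ej]] := (Vr i iV, Vr j jV).
pose w0 := winv wi ++ wj.
have ew0 : i * wev egen' w0 = j by rewrite wev_cat wev_winv -ei -ej mulVKg.
have [m1|m1] := leqP m 1.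
  suff -> : V = [set i; j] by apply: lifts_pair ew0.
  apply/esym/eqP; rewrite eqEcard finset.subUset !finset.sub1set iV jV cards2 ij.
  by rewrite (leq_trans Vm).
have [u [eu su]] := odd_support_path gen' (bar i) w0.
have bE := equivariant_wev (bar_equivariant gen') i w0.
have iu : bar i * wev gen' u = bar j by rewrite eu -bE ew0.
have [|[y [yr yi yj]]|[y [s [yr sp]]]] :=
  isolates_walk iV jV Vm (isolates_start (i := i)) (reach_bar (Vr i iV)) iu.
- by move=> e /su oe; rewrite -ew0 parity_wev oe addbT; case: (parity i e).
(* The nonempty classes are two singletons and the other [m - 1] elements, all smaller than [m]
   since [m] exceeds 1. *)
- apply: (@lifts_glue V _ (fun g => (g == i, g == j)) y) => //.
    move=> g w gV gwV; rewrite xpair_eqE negb_and.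
    by case/orP; [apply: yi|apply: yj].
  move=> c; have small (l : cover) (B : {set cover}) :
      (forall g, g \in B -> g = l) -> (#|B| < m)%N.
    move=> Bl; apply: leq_ltn_trans m1; rewrite -(cards1 l) subset_leq_card //.
    by apply/fintype.subsetP => g /Bl->; rewrite inE.
  have [c1|c1] := boolP c.1.
    apply: (small i) => g; rewrite inE => /andP[_ /eqP/(congr1 fst)/=].
    by rewrite c1 => /eqP.
  have [c2|c2] := boolP c.2.
    apply: (small j) => g; rewrite inE => /andP[_ /eqP/(congr1 snd)/=].
    by rewrite c2 => /eqP.
  have sub : [set g in V | (g == i, g == j) == c] \subset V :\ i :\ j.
    apply/fintype.subsetP => g; rewrite !inE => /andP[-> /eqP ec].
    by move: c1 c2; rewrite -ec /= => -> ->.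
  apply: leq_ltn_trans (subset_leq_card sub) _.
  move: (cardsD1 i V) (cardsD1 j (V :\ i)); rewrite iV !inE jV eq_sym ij /=.
  by move=> e1 e2; move: Vm; rewrite e1 e2 !add1n ltnS.
apply: (@lifts_glue V _ (fun g => parity g (edge gen' y s)) y) => //.
by move=> g w _ _ /parity_neq/traversed_pass[].
Qed.

End Lifting.

Lemma lifting_exists (A : finType) (K : finGroupType) (gen : A -> K) (m : nat) :
  exists (H : finGroupType) (genH : A -> H), lifting gen m genH.
Proof.
(* The induction starts at one vertex, as the expansion step requires [0 < m]; [f] is carried along
   because [below] refers to [K]. *)
suff [H [genH [f [_ L]]]] : exists (H : finGroupType) (genH : A -> H)
    (f : H -> K), equivariant genH gen f /\ lifting gen m.+1 genH.
  by exists H, genH => V Vm; apply: L; apply: leqW.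
elim: m => [|m [H [genH [f [fE L]]]]].
  exists K, gen, id; split=> // V /card_le1P V1 _.
  exists (fun=> 1%g) => g w gV gwV; exists [::]; rewrite mulg1; split=> //.
  apply: below_nil; apply: (mulgI g); rewrite mulg1.
  by have := V1 g gV (g * wev gen w)%g; rewrite gwV inE => /esym/eqP.
exists {perm {ffun H * A -> bool} * H}, (egen genH), (f \o bar); split.
- by move=> g s /=; rewrite bar_equivariant fE.
- exact: lifting_egen fE L isT.
Qed.

(** * Words acting on the base by partial maps *)

Section PartialActions.

Local Open Scope group_scope.

Variables (sigma : signature) (E : ext_problem sigma).

Local Notation F := (free_generated (labels E)).

Fixpoint path_act (x : base E) (w : seq (letter (labels E))) : option (base E) :=
  if w is s :: w' then obind (fun y => path_act y w') (pval s x) else Some x.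

Lemma pvalV (s : letter (labels E)) x y :
  pval s x = Some y -> pval (linv s) y = Some x.
Proof.
case: s => a [] /=; rewrite /pval /= ffunE; case: pickP => [z /eqP az|no].
- by move=> [<-].
- by [].
- by move=> ax; rewrite (proj1 (pautsP (valP a)) _ _ _ ax az).
- by move=> ax; move: (no x); rewrite ax eqxx.
Qed.

(** Cancelled pairs of letters act as restrictions of the identity, so free reduction can only
    enlarge the domain. *)
Lemma path_act_free x w y :
  path_act x w = Some y -> path_act x (fword (wev (@fgen (labels E)) w)) = Some y.
Proof.
elim: w x => [|s w IH] x; first by [].
rewrite [fword _](_ : _ = lmul s (fword (wev (@fgen (labels E)) w))); last first.
  by case: s => a [].
rewrite /=; case e: (pval s x) => [z|] //= /IH {}IH.
case: (fword _) IH => [|t v] /=; first by rewrite e.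
by case: eqP => [->|_] /=; rewrite ?(pvalV e) ?e.
Qed.

Lemma path_act_str R (t u : (arity R).-tuple (base E)) w :
  (forall i, path_act (tnth t i) w = Some (tnth u i)) ->
  base_str (e:=E) t <-> base_str (e:=E) u.
Proof.
elim: w t => [|s w IH] t tu.
  suff -> : t = u by [].
  by apply: eq_from_tnth => i; case: (tu i).
have /choice[v vP] i : exists y, pval s (tnth t i) = Some y.
  by move: (tu i) => /=; case: (pval s _) => // y _; exists y.
have tv : base_str (e:=E) t <-> base_str (e:=E) (mktuple v).
  case: s {tu} vP => a [] vP.
    by apply: iff_sym; apply: (proj2 (pautsP (valP a))) => i;
      rewrite tnth_mktuple; have := pvalV (vP i).
  by apply: (proj2 (pautsP (valP a))) => i; rewrite tnth_mktuple; exact: vP.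
apply: (iff_trans tv); apply: IH => i.
by have := tu i; rewrite /= vP tnth_mktuple.
Qed.

(* Two copies of the base make room to extend all partial maps to permutations:
   where a map is undefined, switch to the copy acted upon by its inverse. *)
Definition completion (s : letter (labels E)) (p : base E * bool) : base E * bool :=
  if pval (if p.2 then linv s else s) p.1 is Some y then (y, p.2)
  else (p.1, ~~ p.2).

Lemma completionK s : cancel (completion s) (completion (linv s)).
Proof.
case=> x b; rewrite /completion /=; case e: (pval _ x) => [y|] /=.
  suff -> : pval (if b then linv (linv s) else linv s) y = Some x by [].
  by case: b e => /pvalV; rewrite ?linvK.
suff -> : (if ~~ b then linv (linv s) else linv s) = (if b then linv s else s).
  by rewrite e negbK.
by case: b {e} => /=; rewrite ?linvK.
Qed.

Definition cperm (a : labels E) : {perm base E * bool} :=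
  perm (can_inj (completionK (a, false))).

Lemma lev_cperm s p : lev cperm s p = completion s p.
Proof.
case: s => a []; rewrite /lev /=; last by rewrite permE.
by apply: (@perm_inj _ (cperm a)); rewrite permKV permE (completionK (a, true)).
Qed.

Lemma lev_cperm_pval s x y : pval s x = Some y -> lev cperm s (x, false) = (y, false).
Proof. by move=> e; rewrite lev_cperm /completion /= e. Qed.

Lemma path_act_cperm x w y : path_act x w = Some y -> wev cperm w (x, false) = (y, false).
Proof.
elim: w x => [|s w IH] x /=; first by rewrite perm1 => -[->].
by case e: (pval s x) => [z|] //= /IH; rewrite permM (lev_cperm_pval e).
Qed.

(** Whether a letter can be applied depends only on the edge it traverses ([good]), so [w'] is
    defined at [x] like [w]. The results agree because the permutations [cperm] extend the partial
    maps. *)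
Lemma path_act_below x w w' y :
  below cperm w' w -> path_act x w = Some y -> path_act x w' = Some y.
Proof.
move=> [ew sub] xy.
pose good (e : {perm base E * bool} * labels E) := exists z z',
  e.1 (x, false) = (z, false) /\ pval (e.2, false) z = Some z'.
have goodE (k : {perm base E * bool}) s z : k (x, false) = (z, false) ->
    good (edge cperm k s) <-> exists z', pval s z = Some z'.
  move=> kz; case: s => a []; rewrite /good /edge /=; last first.
    rewrite kz; split=> [[z1 [z2 [[<-] e]]]|[z2 e]]; first by exists z2.
    by exists z, z2.
  rewrite permM kz; split=> [[z1 [z2 [e1 e2]]]|[z1 e]].
    exists z1; have e3 := lev_cperm_pval e2.
    have : lev cperm (a, false) (lev cperm (a, true) (z, false)) = (z, false).
      by rewrite /lev /= permKV.
    by rewrite e1 e3 => -[<-]; exact: (pvalV e2).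
  by exists z1, z; rewrite (lev_cperm_pval e); split=> //; exact: (pvalV e).
have good_w (k : {perm base E * bool}) z :
    k (x, false) = (z, false) -> path_act z w = Some y ->
    forall e, e \in traversed cperm k w -> good e.
  elim: w k z {ew sub xy} => [|s w IH] k z kz //=.
  case e: (pval s z) => [z1|] //= z1y e'; rewrite inE => /orP[/eqP->|].
    by apply/(goodE _ _ _ kz); exists z1.
  by apply: IH z1y _; rewrite permM kz (lev_cperm_pval e).
have act (k : {perm base E * bool}) z v : k (x, false) = (z, false) ->
    (forall e, e \in traversed cperm k v -> good e) -> exists y', path_act z v = Some y'.
  elim: v k z => [|s v IH] k z kz gv; first by exists z.
  have /(goodE _ _ _ kz)[z1 e] := gv _ (mem_head _ _).
  rewrite /= e /=; apply: IH (k * lev cperm s) _ _ _.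
    by rewrite permM kz (lev_cperm_pval e).
  by move=> e' e'v; apply: gv; rewrite inE e'v orbT.
have x1 : (1 : {perm base E * bool}) (x, false) = (x, false) by rewrite perm1.
have [|y' xy'] := act 1 x w' x1.
  by move=> e /sub; apply: good_w x1 xy _.
by rewrite xy'; have := path_act_cperm xy'; rewrite ew (path_act_cperm xy) => -[->].
Qed.

(** Paths in $\mathcal{P}$ compose and reverse, and right multiplication keeps the word; conversely,
    each letter of [w] contributes a translate of a generating pair. *)
Lemma ThetaP (G : generated_group (labels E)) x (g : G) y h :
  Theta (x, g) (y, h) <->
    exists w, path_act x w = Some y /\ g = wev (@ggen _ G) w * h.
Proof.
split=> [|[w [xy ->]]]; last first.
  elim: w x xy => [|s w IH] x /=; first by rewrite mul1g => -[->]; apply: Theta_refl.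
  case e: (pval s x) => [z|] //= /IH; apply: Theta_trans.
  have := Theta_mulr (wev (@ggen _ G) w * h) (Theta_edge G e).
  by rewrite mul1g mulgA.
have : forall p q : base E * G, Theta p q -> exists w,
    path_act p.1 w = Some q.1 /\ p.2 = wev (@ggen _ G) w * q.2.
  have path_act_cat x1 x2 u v : path_act x1 u = Some x2 -> path_act x1 (u ++ v) = path_act x2 v.
    elim: u x1 => [|s u IH] x1 /=; first by move=> [->].
    by case: (pval s x1) => [z|] //= /IH.
  move=> p q; elim=> {p q}.
  - by move=> p; exists [::]; rewrite /= mul1g.
  - move=> p q _ [w [pq ->]]; exists (winv w); rewrite wev_winv mulKg; split=> //.
    elim: w (p.1) pq => [|s w IH] p1 /=; first by move=> [->].
    case e: (pval s p1) => [z|] //= /IH qz.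
    by rewrite winv_cons (path_act_cat _ _ _ _ qz) /= (pvalV e).
  - move=> p q r _ [u [pu ->]] _ [v [qv ->]]; exists (u ++ v).
    by rewrite (path_act_cat _ _ _ _ pu) wev_cat mulgA.
  - move=> s x1 g1 y1 h1 _ [w [/= xw ->]]; exists w; rewrite /= xw mulgA.
    by split.
  - move=> s x1 x2 e; exists [:: s]; rewrite /= e /= !mulg1.
    by split.
by move=> H /H.
Qed.

Lemma Theta_free x (f f' : F) y :
  Theta (x, f) (y, f') -> path_act x (fword (f * f'^-1)) = Some y.
Proof. by move=> /ThetaP[w [/path_act_free xy ->]]; rewrite mulgK. Qed.

Lemma path_act1_free x y : path_act x (fword (1 : F)) = Some y -> x = y.
Proof. by case. Qed.

(** [V] is a sequence because different tuples may be carried by the same group element. *)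
Definition Theta_lifts (G : generated_group (labels E)) (m : nat) : Prop :=
  forall V : seq G, (size V <= m)%N -> exists h : G -> F, forall g k x y,
    g \in V -> k \in V -> Theta (x, g) (y, k) -> Theta (x, h g) (y, h k).

Lemma theta_lifting m : exists G : generated_group (labels E),
  finite_set (@classical_sets.setT G) /\ Theta_lifts G m.
Proof.
have [H [genH L]] := lifting_exists cperm m.
have gR : group_set [set g | `[< reach genH g >]].
  apply/group_setP; split=> [|g k]; rewrite !inE; first by exists [::].
  by move=> [u ->] [v ->]; exists (u ++ v); rewrite wev_cat.
pose Rg := group gR.
have Rgen a : genH a \in Rg.
  by rewrite inE; apply/asboolP; exists [:: (a, false)]; rewrite /= mulg1.
pose gen a : [subg Rg] := subg Rg (genH a).
have sM (g k : [subg Rg]) : sgval (g * k) = sgval g * sgval k.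
  by apply: sgvalM; rewrite inE.
have sV (g : [subg Rg]) : sgval g^-1 = (sgval g)^-1.
  by apply: (mulgI (sgval g)); rewrite -sM !mulgV.
have genE w : sgval (wev gen w) = wev genH w.
  elim: w => [|[a b] w IH] //=; rewrite IH; congr (_ * _).
  by case: b; rewrite /lev /= ?sV; [congr (_^-1)|]; apply: subgK.
have reachG (g : [subg Rg]) : exists w, g = wev gen w.
  have := subgP g; rewrite inE => /asboolP[w ew].
  by exists w; apply: val_inj; rewrite -[RHS]/(sgval _) genE.
have genP : generates gen.
  move=> P [P1 Pd] Pgen g; have [w ->] := reachG g.
  have PV k : k \in P -> k^-1 \in P by move=> kP; rewrite -[k^-1]mul1g; apply: Pd.
  elim: w => [|s w IH] //=; rewrite -[wev _ _]invgK; apply: Pd; last exact: PV.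
  by case: s => a []; rewrite /lev /= ?PV ?Pgen.
exists (GeneratedGroup genP); split.
  exact: (@finite_finset _ (@classical_sets.setT [subg Rg])).
(* [Theta] multiplies by words on the left, Cayley paths on the right; inverses turn one into the
   other. *)
move=> V Vm; pose V' := [set (sgval g)^-1 | g in V].
have [||h hP] := L V'.
- exact: leq_trans (leq_imset_card _ _) (leq_trans (card_size _) Vm).
- move=> k /imsetP[g _ ->]; have [w ->] := reachG g.
  by exists (winv w); rewrite wev_winv genE.
exists (fun g => (h (sgval g)^-1)^-1) => g k x y gV kV /ThetaP[w [xy eg]].
have ek : (sgval g)^-1 * wev genH w = (sgval k)^-1.
  by rewrite [g]eg [sgval _]sM genE invgM mulgVK.
have [||w' [bw e]] := hP (sgval g)^-1 w; rewrite ?ek; first 2 last.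
- apply: (proj2 (@ThetaP F x _ y _)); exists w'; split; first exact: path_act_below bw xy.
  by rewrite -ek -e invgM mulgA mulgV mul1g.
- by apply/imsetP; exists g.
- by apply/imsetP; exists k.
Qed.

(** * The structures $\mathfrak{X}_{\mathcal{P}}G$ *)

Section Action.

Variable G : generated_group (labels E).

Lemma xcls_repr (y : XP G) : exists x g, y = xcls x g.
Proof.
exists (repr (y : {eq_quot theta_equiv G})%qT).1.
exists (repr (y : {eq_quot theta_equiv G})%qT).2.
by rewrite /xcls -surjective_pairing reprK.
Qed.

Lemma XPhatK s : cancel (XPhat G s) (XPhat G (linv s)).
Proof.
move=> y; have [x [g ->]] := xcls_repr y.
by rewrite /XPhat !xactE [lval G (linv s)](lev_linv (@ggen _ G)) mulgK.
Qed.

Lemma XPhat_str s R t : XPstr G R t -> XPstr G R (map_tuple (XPhat G s) t).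
Proof.
move=> [g [u [ut ->]]]; exists (g * lval G s), u; split=> //.
by apply: eq_from_tnth => i; rewrite !tnth_map /XPhat xactE.
Qed.

Lemma XPhat_automorphism s : automorphism (XPstr G) (XPhat G s).
Proof.
split=> [|R t].
  by exists (XPhat G (linv s)); [exact: XPhatK|rewrite -{2}[s]linvK; exact: XPhatK].
split; first exact: XPhat_str.
move=> /(XPhat_str (linv s)).
suff -> : map_tuple (XPhat G (linv s)) (map_tuple (XPhat G s) t) = t by [].
by apply: eq_from_tnth => i; rewrite !tnth_map XPhatK.
Qed.

Lemma finite_XP : finite_set (@classical_sets.setT G) ->
  finite_set (@classical_sets.setT (XP G)).
Proof.
move=> Gfin.
have := finite_image (fun p : base E * G => xcls p.1 p.2)
  (finite_setX (@finite_finset (base E) classical_sets.setT) Gfin).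
apply: sub_finite_set => y _; have [x [g ->]] := xcls_repr y.
by exists (x, g).
Qed.

Lemma finite_XPstr R : finite_set (@classical_sets.setT G) ->
  finite_set (XPstr G R).
Proof.
move=> Gfin.
have := finite_image
  (fun p : G * (arity R).-tuple (base E) => map_tuple (fun x => xcls x p.1) p.2)
  (finite_setX Gfin
    (@finite_finset _ (@classical_sets.setT ((arity R).-tuple (base E))))).
by apply: sub_finite_set => t [g [u [_ ->]]]; exists (g, u).
Qed.

Lemma XP_solution :
  Theta_lifts G 2 ->
  solution (XPstr G) (XPincl G) (XPhat G).
Proof.
move=> L; split.
- split=> [x y /xcls_eqP xy|R t].
    have [//|h hP] := L [:: 1 : G].
    have := Theta_free (hP 1 1 x y (mem_head _ _) (mem_head _ _) xy).
    by rewrite mulgV => /path_act1_free.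
  split=> [Rt|[g [u [Ru e]]]]; first by exists 1, t.
  have [//|h hP] := L [:: 1 : G; g].
  (* Over [G], different coordinates of [t] may need different words to reach [u]; over [F], one
     reduced word serves them all, so [path_act_str] applies. *)
  suff tu i : path_act (tnth t i) (fword (h 1 * (h g)^-1)) = Some (tnth u i).
    exact: (proj2 (path_act_str tu) Ru).
  apply: Theta_free; apply: hP; rewrite ?inE ?eqxx ?orbT //.
  by apply/xcls_eqP; move/(congr1 (fun v => tnth v i)): e; rewrite !tnth_map.
- exact: XPhat_automorphism.
- move=> s x y /(Theta_edge G) e.
  by rewrite /XPhat /XPincl xactE mul1g; apply/xcls_eqP.
- exact: XPhatK.
Qed.

(** For each tuple of [U], a group element carrying a base tuple to it is chosen and lifted to [F].
    The images agree on common elements as [h] preserves [Theta]; the weight bounds the number of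
    tuples. *)
Lemma XP_homomorphism n (Z : set (XP G)) (U : structure sigma Z) :
  finite_set (@classical_sets.setT G) ->
  Theta_lifts G n ->
  weak_substructure (XPstr G) U -> (weight U <= n)%N ->
  exists phi : Z -> XP F, homomorphism U (XPstr F) phi.
Proof.
move=> Gfin L UX Un.
pose spans (R : sigma) (t : (arity R).-tuple Z) (g : G) u :=
  base_str (e:=E) u /\ map_tuple val t = map_tuple (fun x => xcls x g) u.
have /choice[gam gamP] (i : {R : sigma & (arity R).-tuple Z}) :
    exists g, U (tag i) (tagged i) -> exists u, spans _ (tagged i) g u.
  have [/UX[g [u tu]]|no] := pselect (U (tag i) (tagged i)); last by exists 1.
  by exists g => _; exists u.
pose V := [seq gam (Tagged (fun R => (arity R).-tuple Z) t) |
  R <- enum sigma, t <- fset_set (U R)].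
have [|h hP] := L V.
  rewrite size_allpairs_dep sumnE big_map big_enum /=.
  exact: leq_trans (leq_addl _ _) Un.
(* Finiteness makes [fset_set] list all of [U R] instead of defaulting to [fset0]. *)
have finU R : finite_set (U R).
  apply: (sub_finite_set (UX R)); apply: finite_preimage (finite_XPstr R Gfin).
  move=> t u _ _ /(congr1 val) /= e; apply: val_inj.
  exact: (inj_map val_inj e).
have gamV R t : U R t -> gam (Tagged (fun R => (arity R).-tuple Z) t) \in V.
  move=> Ut; apply/allpairsPdep; exists R, t; split; rewrite ?mem_enum //.
  by rewrite in_fset_set; [exact: mem_set|exact: finU].
have /choice[phi phiP] (z : Z) : exists z' : XP F, forall R t u p,
    U R t -> spans R t (gam (Tagged (fun R => (arity R).-tuple Z) t)) u ->
    tnth t p = z -> z' = xcls (tnth u p) (h (gam (Tagged _ t))).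
  have same R (t : (arity R).-tuple Z) g u p : spans R t g u ->
      val (tnth t p) = xcls (tnth u p) g.
    by move=> [_ /(congr1 (fun v => tnth v p))]; rewrite !tnth_map.
  have [[R [t [u [p [Ut tu tp]]]]]|no] := pselect (exists R t u p, [/\ U R t,
      spans R t (gam (Tagged (fun R => (arity R).-tuple Z) t)) u & tnth t p = z]).
    exists (xcls (tnth u p) (h (gam (Tagged _ t)))) => R' t' u' p' Ut' tu' tp'.
    apply/xcls_eqP/hP; rewrite ?gamV //; apply/xcls_eqP.
    by rewrite -(same _ _ _ _ _ tu) -(same _ _ _ _ _ tu') tp tp'.
  (* An element in no tuple may go anywhere; its representative shows that the base is not empty. *)
  have [x _] := xcls_repr (val z); exists (xcls x 1) => R t u p Ut tu tp.
  by case: no; exists R, t, u, p.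
exists phi => R t Ut; have [u tu] := gamP (Tagged _ t) Ut.
exists (h (gam (Tagged _ t))), u; split; first exact: proj1 tu.
apply: eq_from_tnth => p; rewrite !tnth_map.
exact: (phiP _ R t u p Ut tu).
Qed.

End Action.

End PartialActions.

(** * Finite solutions that map locally to $\mathfrak{X}_{\mathcal{P}}F$ *)

Local Open Scope classical_set_scope.

Theorem proposition4p17 :
  forall (sigma : signature) (n : nat), (0 < n)%N ->
  forall E : ext_problem sigma,
  exists G : generated_group (labels E),
    [/\ finite_set [set: XP G],
        solution (XPstr G) (XPincl G) (XPhat G)
      & forall (Z : set (XP G)) (U : structure sigma Z),
          weak_substructure (XPstr G) U ->
          (weight U <= n)%N ->
          exists phi : Z -> XP (free_generated (labels E)),
            homomorphism U (XPstr (free_generated (labels E))) phi].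
Proof.
(* The homomorphisms need [n] vertices, the solution needs 2; [n.+2] covers both. *)
move=> sigma n _ E; have [G [Gfin L]] := theta_lifting E n.+2.
exists G; split; first exact: finite_XP.
  by apply: XP_solution => V V2; apply: L; apply: leq_trans V2 _.
move=> Z U UX Un; apply: (XP_homomorphism Gfin _ UX Un) => V Vn.
by apply: L; apply/leqW/leqW.
Qed.
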